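(* Consider the two-way unsplittable trading problem with at most $k\ge 1$ trades, where all prices lie in the known range $[1,M]$ with $M>1$, and let $\varphi=M$. Consider the following online algorithm: upon release of the $i$-th price $p(i)$, if $i=T$ (the last day) and it holds stock, it sells at price $p(T)$; otherwise (if $i<T$), if $p(i)\le M^{1/3}$, it currently holds no stock and it has not used up all $k$ trades, it buys at price $p(i)$; else if $p(i)\ge M^{2/3}$ and it currently holds stock, it sells at price $p(i)$. Then this algorithm has competitive ratio $\varphi^{(2k+1)/3}$ (i.e., on every price sequence with prices in $[1,M]$, the return of the optimal offline algorithm is at most $\varphi^{(2k+1)/3}$ times the return of this algorithm).
   Context: Two-way unsplittable trading problem: a sequence of prices $p(1),\ldots,p(T)$ (positive reals), one per day, is revealed online; the horizon length $T$ is not known to the online algorithm in advance, but when day $i$ arrives the algorithm learns whether $i=T$. The investor starts with cash and may make at most $k$ trades. A trade is a pair of days $(b,s)$ with $b<s$: on day $b$ all available money is used to buy the stock at price $p(b)$, and on day $s$ all stock is sold at price $p(s)$. Trades cannot overlap (a sale must happen before the next purchase), there is no short selling, no buying on the last day $T$, and any stock held on day $T$ is sold at price $p(T)$. The gain of a trade $(b,s)$ is $p(s)/p(b)$; the return is the product of the gains of the trades made ($1$ if none). OPT is the optimal offline algorithm making at most $k$ trades. The competitive ratio of an online algorithm is the supremum over admissible price sequences of (return of OPT)/(return of the algorithm). In this model all prices lie in $[m,M]$ with $m,M$ known in advance; here (as the paper does without loss of generality) $m=1$, so the fluctuation ratio $\varphi=M/m$ equals $M$. *)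

(* Defs.v *)
From HB Require Import structures.
From mathcomp Require Import all_boot all_order all_algebra.
From mathcomp Require Import all_classical all_reals all_analysis.

Set Implicit Arguments.
Unset Strict Implicit.
Unset Printing Implicit Defensive.

Import Order.TTheory GRing.Theory Num.Theory.

Local Open Scope ring_scope.
Local Open Scope classical_set_scope.

(* A price sequence is given by its horizon T and p : nat -> R; only the values
   p 1, ..., p T matter.  The lower end of the price range is m = 1. *)
Definition admissible (R : realType) (M : R) (T : nat) (p : nat -> R) : Prop :=
  (0 < T)%N /\ forall i : nat, (1 <= i <= T)%N -> 1 <= p i <= M.

(* (buying day, selling day) *)
Notation trade := (nat * nat)%type (only parsing).

Definition valid_schedule (k T : nat) (s : seq trade) : bool :=
  [&& (size s <= k)%N,
      all (fun t : trade => (1 <= t.1)%N && (t.1 < t.2 <= T)%N) s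
    & sorted (fun t u : trade => (t.2 < u.1)%N) s].

Definition gain (R : realType) (p : nat -> R) (t : trade) : R := p t.2 / p t.1.

Definition schedule_return (R : realType) (p : nat -> R) (s : seq trade) : R :=
  \prod_(t <- s) gain p t.

(* There are finitely many valid schedules, so this is a maximum: see
   opt_return_max below. *)
Definition opt_return (R : realType) (k T : nat) (p : nat -> R) : R :=
  sup [set schedule_return p s | s in [set s | valid_schedule k T s]].

Inductive action : Type := Buy | Sell | Stay.

(* The completed trades in chronological order, and the buying day of the stock
   currently held, if any. *)
Record account : Type := Account { completed : seq trade; held : option nat }.

Definition holds_stock (a : account) : bool := isSome (held a).

(* A purchase uses up a trade, even before the stock is sold. *)
Definition trades_used (a : account) : nat := (size (completed a) + holds_stock a)%N.

(* The arguments are the account, the prices of the past days, the price of the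
   current day, and whether the current day is the last one. *)
Definition online_algorithm (R : realType) : Type :=
  account -> seq R -> R -> bool -> action.

(* The rules of the market on day i.  Actions that are not allowed have no
   effect, and stock held on the last day is sold whatever the action is. *)
Definition execute (k i : nat) (is_last : bool) (c : action) (a : account) :
    account :=
  match held a, c with
  | Some b, Sell => Account (rcons (completed a) (b, i)) None
  | Some b, _ => if is_last then Account (rcons (completed a) (b, i)) None else a
  | None, Buy => if ~~ is_last && (trades_used a < k)%N
                 then Account (completed a) (Some i) else a
  | None, _ => a
  end.

(* The account at the end of day i; the horizon T is only used to tell the
   algorithm and the market whether a day is the last one. *)
Fixpoint run (R : realType) (k : nat) (A : online_algorithm R)
    (T : nat) (p : nat -> R) (i : nat) : account :=
  if i is j.+1 then
    let a := run k A T p j in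
    let is_last := i == T in
    execute k i is_last (A a [seq p d | d <- iota 1 j] (p i) is_last) a
  else Account [::] None.

Definition alg_return (R : realType) (k : nat) (A : online_algorithm R)
    (T : nat) (p : nat -> R) : R :=
  schedule_return p (completed (run k A T p T)).

Definition competitive_ratio (R : realType) (M : R) (k : nat)
    (A : online_algorithm R) : \bar R :=
  ereal_sup [set r : \bar R | exists (T : nat) (p : nat -> R),
    admissible M T p /\ r = (opt_return k T p / alg_return k A T p)%:E].

Definition threshold_algorithm (R : realType) (M : R) (k : nat) :
    online_algorithm R :=
  fun a _ price is_last =>
    if is_last then
      if holds_stock a then Sell else Stay
    else if [&& price <= M `^ (1 / 3), ~~ holds_stock a & (trades_used a < k)%N]
      then Buy
    else if (M `^ (2 / 3) <= price) && holds_stock a then Sell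
    else Stay.

Lemma valid_schedules_finite (k T : nat) :
  exists L : seq (seq trade), forall s, valid_schedule k T s -> s \in L.
Proof.
have [E EP] : exists E : seq trade,
    forall x y : nat, (x < y <= T)%N -> (x, y) \in E.
  exists [seq (x, y) | x <- iota 0 T.+1, y <- iota 0 T.+1] => x y /andP[xy yT].
  apply: allpairs_f; rewrite mem_iota add0n ltnS //=.
  exact: leq_trans (ltnW xy) yT.
pose bnd (t : trade) := (1 <= t.1)%N && (t.1 < t.2 <= T)%N.
suff [L HL] : exists L : seq (seq trade),
    forall s, (size s <= k)%N -> all bnd s -> s \in L.
  by exists L => s /and3P[sk sb _]; apply: HL.
elim: k => [|k [L HL]].
  by exists [:: [::]] => -[|t s].
exists ([::] :: [seq t :: s | t <- E, s <- L]) => -[|[x y] s] // sk.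
case/andP=> /andP[/= _ xyT] sb.
rewrite inE; apply/orP; right.
apply: allpairs_f; first exact: EP.
exact: HL.
Qed.

Lemma opt_return_max (R : realType) (k T : nat) (p : nat -> R) :
  (exists2 s, valid_schedule k T s & opt_return k T p = schedule_return p s) /\
  (forall s, valid_schedule k T s -> schedule_return p s <= opt_return k T p).
Proof.
have v0 : valid_schedule k T [::] by [].
have [L HL] := valid_schedules_finite k T.
have [s vs smax] : exists2 s, valid_schedule k T s & forall s',
    valid_schedule k T s' -> schedule_return p s' <= schedule_return p s.
  suff [s vs smax] : exists2 s, valid_schedule k T s & forall s', s' \in L ->
      valid_schedule k T s' -> schedule_return p s' <= schedule_return p s.
    by exists s => // s' vs'; apply: smax => //; apply: HL.
  elim: L {HL} => [|u L [s vs smax]]; first by exists [::].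
  case vu: (valid_schedule k T u); last first.
    exists s => // s'; rewrite inE => /orP[/eqP->|]; first by rewrite vu.
    exact: smax.
  have [us|su] := leP (schedule_return p u) (schedule_return p s).
    by exists s => // s'; rewrite inE => /orP[/eqP->|] //; apply: smax.
  exists u => // s'; rewrite inE => /orP[/eqP->|s'L vs'] //.
  exact: le_trans (smax _ s'L vs') (ltW su).
have ub : ubound [set schedule_return p s | s in [set s | valid_schedule k T s]]
    (schedule_return p s).
  by move=> _ [s' vs' <-]; apply: smax.
have optE : opt_return k T p = schedule_return p s.
  apply/eqP; rewrite eq_le; apply/andP; split.
    by apply: ge_sup => //; exists (schedule_return p s), s.
  by apply: ub_le_sup; [exists (schedule_return p s)|exists s].
by split; [exists s|move=> s' vs'; rewrite optE; apply: smax].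
Qed.

(* Main.v *)
Require Import Defs.
From HB Require Import structures.
From mathcomp Require Import all_boot all_order all_algebra.
From mathcomp Require Import all_classical all_reals all_analysis.
From mathcomp Require Import zify lra.

Set Implicit Arguments.
Unset Strict Implicit.
Unset Printing Implicit Defensive.

Import Order.TTheory GRing.Theory Num.Theory.
Local Open Scope ring_scope.

(** Write [a = M^(1/3)].  Call a sale good if its price is at least [a^2], and
    an offline trade big if it buys at a price at most [a] and sells at a price
    at least [a^2].  A trade that is not big gains at most [a^2], a big one at
    most [a^3].  The algorithm buys at prices at most [a], so each of its good
    sales gains at least [a], and only the sale forced on the last day can be
    bad, in which case it loses at most a factor [a].  If a big trade starts
    while the algorithm still has trades to spend, the algorithm holds stock
    from its first day on, hence makes a good sale before the trade ends.  So
    the number of big trades is at most the number [g] of good sales, the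
    optimum is at most [a^(2k+g)], and the algorithm gets at least
    [a^(g-1)]. *)

Definition threshold_run (R : realType) (M : R) (k T : nat) (p : nat -> R)
    (i : nat) : account := run k (threshold_algorithm M k) T p i.

Definition good_sale (R : realType) (M : R) (p : nat -> R) (t : nat * nat) :
    bool := M `^ (2 / 3) <= p t.2.

Definition big_trade (R : realType) (M : R) (p : nat -> R) (t : nat * nat) :
    bool := (p t.1 <= M `^ (1 / 3)) && good_sale M p t.

Definition good_sales (R : realType) (M : R) (k T : nat) (p : nat -> R)
    (i : nat) : nat :=
  count (good_sale M p) (completed (threshold_run M k T p i)).

Lemma ltr_powR_exponent (R : realType) (M : R) : 1 < M ->
  {mono powR M : x y / x < y}.
Proof.
move=> M1 x y; have M0 : 0 < M by lra.
by rewrite /powR gt_eqF // ltr_expR ltr_pM2r // ln_gt0.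
Qed.

Lemma cube_root_gt1 (R : realType) (M : R) : 1 < M -> 1 < M `^ (1 / 3).
Proof. by move=> M1; rewrite -[ltLHS](powRr0 M) ltr_powR_exponent //; lra. Qed.

Lemma cube_rootX (R : realType) (M : R) (n : nat) : 0 <= M ->
  M `^ (n%:R / 3) = (M `^ (1 / 3)) ^+ n.
Proof.
by move=> M0; rewrite -powR_mulrn ?powR_ge0// -powRrM mulrC div1r.
Qed.

(** Merges the decision with the market rules; without stock in hand, [trades_used] is just the
    number of completed trades. *)
Lemma threshold_runS (R : realType) (M : R) (k T : nat) (p : nat -> R)
    (i : nat) :
  threshold_run M k T p i.+1 =
  let a := threshold_run M k T p i in
  if held a is Some b then
    if (i.+1 == T) || (M `^ (2 / 3) <= p i.+1)
    then Account (rcons (completed a) (b, i.+1)) None else a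
  else
    if [&& i.+1 != T, p i.+1 <= M `^ (1 / 3) & (size (completed a) < k)%N]
    then Account (completed a) (Some i.+1) else a.
Proof.
rewrite /threshold_run /=; case: (run _ _ _ _ i) => c h.
rewrite /execute /threshold_algorithm /trades_used /holds_stock /=.
case: h => [b|] /=; rewrite ?addn0 ?andbF ?andbT; case: (i.+1 == T) => //=.
  by case: (_ <= _).
by case: (_ <= _); case: (_ < _)%N.
Qed.

Lemma threshold_run_bought_low (R : realType) (M : R) (k T : nat)
    (p : nat -> R) (i : nat) :
  let low b := (0 < b <= i)%N && (p b <= M `^ (1 / 3)) in
  let a := threshold_run M k T p i in
  all (fun t => low t.1 && (0 < t.2 <= i)%N) (completed a)
    && oapp low true (held a).
Proof.
elim: i => //= i; rewrite threshold_runS /=.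
case: (threshold_run _ _ _ _ i) => c h /= /andP[cP hP].
have lowS b : (0 < b <= i)%N -> (0 < b <= i.+1)%N by lia.
have cP' : all (fun t => [&& (0 < t.1 <= i.+1)%N, p t.1 <= M `^ (1 / 3)
    & (0 < t.2 <= i.+1)%N]) c.
  apply: sub_all cP => t /andP[/andP[t1 ->] t2].
  by rewrite !lowS.
under eq_all do rewrite -andbA.
case: h hP => [b|] /= hP.
  have {hP} /andP[b1 b2] := hP.
  case: ifP => _ /=; last by rewrite cP' lowS.
  by rewrite all_rcons /= lowS // b2 cP' /= !leqnn.
by case: ifP => [/and3P[_ pl _]|_] /=; rewrite cP' //= leqnn pl.
Qed.

(** No sale is forced before the last day, so each one has passed the price test. *)
Lemma good_salesE (R : realType) (M : R) (k T : nat) (p : nat -> R)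
    (i : nat) : (i < T)%N ->
  good_sales M k T p i = size (completed (threshold_run M k T p i)).
Proof.
elim: i => // i IH iT; move: (IH (ltnW iT)).
rewrite /good_sales threshold_runS /= (ltn_eqF iT) /=.
case: (threshold_run _ _ _ _ i) => c [b|] /= cP; case: ifP => //= h.
by rewrite -cats1 count_cat size_cat /= cP /good_sale /= h.
Qed.

Lemma bad_sales_le1 (R : realType) (M : R) (k T : nat) (p : nat -> R) :
  (size (completed (threshold_run M k T p T)) <= (good_sales M k T p T).+1)%N.
Proof.
case: T => // T; have := good_salesE M k p (ltnSn T).
rewrite /good_sales threshold_runS /=.
case: (threshold_run _ _ _ _ T) => c [b|] /=; rewrite eqxx /= => cP.
  by rewrite -cats1 count_cat size_cat /= cP; lia.
by rewrite cP.
Qed.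

Lemma good_sales_mono (R : realType) (M : R) (k T : nat) (p : nat -> R)
    (i j : nat) : (i <= j)%N ->
  (good_sales M k T p i <= good_sales M k T p j)%N.
Proof.
move=> /subnKC <-; elim: (j - i)%N => [|n IH]; first by rewrite addn0.
apply: leq_trans IH _; rewrite addnS /good_sales threshold_runS /=.
case: (threshold_run _ _ _ _ _) => c [b|] /=; case: ifP => //= _.
by rewrite -cats1 count_cat leq_addr.
Qed.

(** A low price never triggers a sale before the last day, and without stock only a lack of trades
    prevents a purchase; the trades completed so far all ended in good sales. *)
Lemma holds_or_exhausted (R : realType) (M : R) (k T : nat) (p : nat -> R)
    (i : nat) : (0 < i < T)%N -> p i <= M `^ (1 / 3) ->
  p i < M `^ (2 / 3) ->
  holds_stock (threshold_run M k T p i) || (k <= good_sales M k T p i)%N.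
Proof.
case: i => // i iT pl ph; rewrite good_salesE // threshold_runS /=.
have /ltn_eqF -> : (i.+1 < T)%N by [].
rewrite leNgt ph pl /=.
case: (threshold_run _ _ _ _ _) => c [b|] //=.
by case: ltnP => //= ->; rewrite orbT.
Qed.

Lemma holds_or_sells (R : realType) (M : R) (k T : nat) (p : nat -> R)
    (i j : nat) : (i <= j < T)%N -> holds_stock (threshold_run M k T p i) ->
  holds_stock (threshold_run M k T p j) ||
  (good_sales M k T p i < good_sales M k T p j)%N.
Proof.
move=> /andP[/subnKC <-] + hi; elim: (j - i)%N => [|n IH].
  by rewrite addn0 hi.
rewrite addnS => nT; have := IH (ltnW nT).
case/orP => [|lt]; last first.
  by rewrite (leq_trans lt) ?orbT// good_sales_mono.
have := good_sales_mono M k T p (leq_addr n i).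
rewrite /good_sales [threshold_run _ _ _ _ (i + n).+1]threshold_runS /=.
rewrite (ltn_eqF nT) /=.
case: (threshold_run _ _ _ _ (i + n)) => c [b|] //= le _.
case: ifP => //= h.
by rewrite -cats1 count_cat /= /good_sale /= h addn1 ltnS.
Qed.

(** Stock held on day [b] is either sold before day [s], at a good price, or still held when day [s]
    offers one. This covers [s = T]: the forced sale is then good. *)
Lemma big_trade_good_sale (R : realType) (M : R) (k T : nat) (p : nat -> R)
    (b s : nat) : M `^ (1 / 3) < M `^ (2 / 3) ->
  (0 < b < s)%N -> (s <= T)%N -> big_trade M p (b, s) ->
  (k <= good_sales M k T p b)%N ||
  (good_sales M k T p b < good_sales M k T p s)%N.
Proof.
move=> lt; case: s => [|s]; rewrite ?andbF // => /andP[b0 bs] sT.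
case/andP => /= pb ps.
have bT : (0 < b < T)%N by lia.
have [hb|->] := orP (holds_or_exhausted k bT pb (le_lt_trans pb lt));
  last by [].
apply/orP; right.
have bsT : (b <= s < T)%N by lia.
have /orP[hs|h] := holds_or_sells bsT hb; last first.
  by rewrite (leq_trans h) // good_sales_mono.
have /(good_sales_mono M k T p) : (b <= s)%N by [].
move: hs; rewrite /good_sales [threshold_run _ _ _ _ s.+1]threshold_runS /=.
case: (threshold_run _ _ _ _ s) => c [d|] //= _ le.
rewrite /good_sale /= in ps; rewrite ps orbT /=.
by rewrite -cats1 count_cat /= /good_sale /= ps addn1 ltnS.
Qed.

(** Offline trades occupy disjoint periods, so the good sales charged to different big trades are
    distinct. Here [d] is the day on which the previous trade ended. *)
Lemma count_big_trades (R : realType) (M : R) (k T : nat) (p : nat -> R)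
    (d : nat) (s : seq (nat * nat)) : M `^ (1 / 3) < M `^ (2 / 3) ->
  (good_sales M k T p T < k)%N ->
  all (fun t => (1 <= t.1)%N && (t.1 < t.2 <= T)%N) s ->
  path (fun t u => (t.2 < u.1)%N) (0%N, d) s -> (d <= T)%N ->
  (good_sales M k T p d + count (big_trade M p) s <= good_sales M k T p T)%N.
Proof.
move=> lt gk; elim: s d => [|[b e] s IH] d /=.
  by move=> _ _ dT; rewrite addn0 good_sales_mono.
move=> /andP[/and3P[b1 be eT] sT] /andP[db es] dT.
(* The relation ignores the buying day of its first argument, so the dummy 0 can replace [b]. *)
have {}es : path (fun t u => (t.2 < u.1)%N) (0%N, e) s by case: s es {IH sT}.
have := IH e sT es eT.
have := good_sales_mono M k T p (ltnW db).
have := good_sales_mono M k T p (ltnW be).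
have bT := leq_trans (ltnW be) eT.
have := good_sales_mono M k T p bT.
case: (boolP (big_trade M p (b, e))) => [bt|_] /=; last by lia.
have be' : (0 < b < e)%N by rewrite b1.
by have /orP[] := big_trade_good_sale k lt be' eT bt; lia.
Qed.

Lemma gain_le (R : realType) (M : R) (p : nat -> R) (t : nat * nat) :
  0 <= M -> 1 <= p t.1 -> p t.2 <= M ->
  gain p t <= (M `^ (1 / 3)) ^+ (2 + big_trade M p t).
Proof.
case: t => b e /= M0 pb1 peM.
rewrite /gain /= ler_pdivrMr ?(lt_le_trans ltr01) //.
have a0 : 0 <= M `^ (1 / 3) by exact: powR_ge0.
have Ma : M <= (M `^ (1 / 3)) ^+ 3.
  by rewrite -cube_rootX // divff ?powRr1 // pnatr_eq0.
have := cube_rootX 2 M0; rewrite /big_trade /good_sale /= => ->.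
move: (M `^ (1 / 3)) a0 Ma => a a0 Ma.
have [|] /= := boolP ((p b <= a) && (a ^+ 2 <= p e)).
  move=> _; rewrite (le_trans peM) // (le_trans Ma) // -[leLHS]mulr1.
  by rewrite ler_wpM2l // exprn_ge0.
(* Either the purchase costs more than [a] and the sale yields at most [a ^+ 3], or the sale yields
   less than [a ^+ 2] and the purchase costs at least 1. *)
rewrite negb_and -!ltNge addn0 => /orP[h|h].
  rewrite (le_trans peM) // (le_trans Ma) // exprSr.
  by rewrite ler_wpM2l ?exprn_ge0 // ltW.
by rewrite (le_trans (ltW h)) // -[leLHS]mulr1 ler_wpM2l // exprn_ge0.
Qed.

Lemma schedule_return_le (R : realType) (M : R) (T : nat) (p : nat -> R)
    (s : seq (nat * nat)) : admissible M T p ->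
  all (fun t => (1 <= t.1)%N && (t.1 < t.2 <= T)%N) s ->
  0 <= schedule_return p s
    <= (M `^ (1 / 3)) ^+ (2 * size s + count (big_trade M p) s).
Proof.
move=> [_ adm]; elim: s => [|[b e] s IH] /=.
  by rewrite /schedule_return big_nil expr0 ler01 lexx.
move=> /andP[/and3P[b1 be eT] /IH /andP[r0 rle]].
rewrite /schedule_return big_cons -/(schedule_return p s).
have /adm/andP[pb1 _] : (1 <= b <= T)%N by rewrite b1 (leq_trans (ltnW be)).
have /adm/andP[pe1 peM] : (1 <= e <= T)%N by rewrite (ltn_trans b1).
have g0 : 0 <= gain p (b, e) by rewrite divr_ge0 // ?(le_trans ler01).
rewrite mulr_ge0 //= mulnS addnACA exprD ler_pM // gain_le //.
by rewrite (le_trans ler01) // (le_trans pe1).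
Qed.

(** A sale in [P] gains at least [a ^+ 2 / a], any other at least [1 / a]; the losses are moved to
    the right to avoid negative exponents. *)
Lemma sales_return_ge (R : realType) (a : R) (P : pred (nat * nat))
    (p : nat -> R) (s : seq (nat * nat)) : 0 < a ->
  all (fun t => [&& 0 < p t.1, p t.1 <= a & 1 <= p t.2]) s ->
  (forall t, P t -> a ^+ 2 <= p t.2) ->
  0 < schedule_return p s /\
  a ^+ count P s <= a ^+ (size s - count P s) * schedule_return p s.
Proof.
move=> a0 sP PP; elim: s sP => [_|[b e] s IH] /=.
  by rewrite /schedule_return big_nil subnn !expr0 mulr1 ltr01.
case/andP => /and3P[/= pb0 pba pe1] /IH [r0 rle].
rewrite /schedule_return big_cons -/(schedule_return p s).
have pe0 : 0 < p e by lra.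
split; first by rewrite mulr_gt0 // divr_gt0.
have cs := count_size P s.
case: (boolP (P (b, e))) => [Pt|_] /=; rewrite ?add1n ?add0n.
  rewrite subSS exprS mulrCA ler_pM ?exprn_ge0 ?(ltW a0) //.
  have /= := PP _ Pt; rewrite /gain /= ler_pdivlMr // expr2; apply: le_trans.
  exact: ler_wpM2l (ltW a0) _ _ pba.
rewrite subSn // exprS mulrACA -[leLHS]mul1r ler_pM ?exprn_ge0 ?ler01 ?(ltW a0) //.
rewrite /gain mulrA ler_pdivlMr // mul1r (le_trans pba) //.
by rewrite -[leLHS]mulr1 ler_wpM2l // ltW.
Qed.

Theorem theorem2 (R : realType) (M : R) (k : nat)
    (M_gt1 : 1 < M) (k_ge1 : (1 <= k)%N) :
  (competitive_ratio M k (threshold_algorithm M k)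
     <= (M `^ ((2 * k + 1)%:R / 3))%:E)%E /\
  forall (T : nat) (p : nat -> R), admissible M T p ->
    opt_return k T p
      <= M `^ ((2 * k + 1)%:R / 3)
         * alg_return k (threshold_algorithm M k) T p.
Proof.
set a := M `^ (1 / 3).
have M0 : 0 <= M by lra.
have a2 : M `^ (2 / 3) = a ^+ 2 by exact: cube_rootX.
have a1 : 1 < a := cube_root_gt1 M_gt1.
have a0 : 0 < a by lra.
have lt12 : M `^ (1 / 3) < M `^ (2 / 3) by rewrite ltr_powR_exponent //; lra.
rewrite cube_rootX // -/a.
(* Positivity of the algorithm's return turns the product bound into a bound on the ratio. *)
suff main T p : admissible M T p ->
    0 < alg_return k (threshold_algorithm M k) T p /\
    opt_return k T p
      <= a ^+ (2 * k + 1) * alg_return k (threshold_algorithm M k) T p.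
  split; last by move=> T p /main[].
  apply: ge_ereal_sup => _ [T [p [/main[r0 rle] ->]]].
  by rewrite lee_fin ler_pdivrMr.
move=> adm; have [_ pM] := adm.
rewrite /alg_return -/(threshold_run M k T p T).
set c := completed _.
have [] := @sales_return_ge R a (good_sale M p) p c a0.
- have /andP[+ _] := threshold_run_bought_low M k T p T.
  apply: sub_all => t /= /andP[/andP[/pM/andP[t1 _] ->] /pM/andP[-> _]].
  by rewrite (lt_le_trans ltr01 t1).
- by move=> t; rewrite /good_sale a2.
move=> r0 rle; split => //.
have [[s /and3P[sk sT ss] ->] _] := opt_return_max k T p.
have /andP[_ /le_trans->] // := schedule_return_le adm sT.
rewrite -/a; set g := count _ c in rle.
have cg : (count (big_trade M p) s <= g)%N.
  (* With [k] good sales the size of the schedule suffices; otherwise the charging argument starts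
     from day 0. *)
  have [kg|gk] := leqP k g.
    by rewrite (leq_trans (count_size _ _)) // (leq_trans sk).
  apply: leq_trans (leq_addl _ _)
    (@count_big_trades R M k T p 0 s lt12 gk sT _ (leq0n T)).
  (* Days are numbered from 1, so the first trade starts after the sentinel day 0. *)
  by case: s ss sT {sk} => //= t s -> /andP[/andP[-> _] _].
have bad : (size c - g <= 1)%N.
  by rewrite leq_subLR addn1; exact: bad_sales_le1.
have gle : a ^+ g <= a * schedule_return p c.
  apply: le_trans rle _; rewrite ler_wpM2r ?(ltW r0) //.
  by rewrite -[leRHS]expr1 ler_weXn2l // ltW.
rewrite addn1 exprSr -mulrA.
apply: (@le_trans _ _ (a ^+ (2 * k + g))).
  by rewrite ler_weXn2l ?(ltW a1) // leq_add // leq_mul2l.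
by rewrite exprD ler_wpM2l // exprn_ge0 // ltW.
Qed.
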